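(* Let $\mathcal{V}$ be a non-trivial commutative unital quantale and let $(X,a)$ be a $\mathcal{V}$-category. Then no $\mathcal{V}$-functor $\mathsf{H}(X,a)\to(X,a)$ is an embedding.
   Context: A commutative unital quantale $\mathcal{V}=(\mathcal{V},\otimes,k)$ is a complete lattice with a commutative monoid structure $(\otimes,k)$ such that $u\otimes-$ preserves arbitrary suprema for each $u$. It is trivial if $\mathcal{V}=\{k\}$, and non-trivial otherwise. A $\mathcal{V}$-category $(X,a)$ is a set $X$ with a map $a\colon X\times X\to\mathcal{V}$ such that $k\le a(x,x)$ and $a(x,y)\otimes a(y,z)\le a(x,z)$ for all $x,y,z\in X$. A $\mathcal{V}$-functor $f\colon(X,a)\to(Y,b)$ is a map with $a(x,y)\le b(f(x),f(y))$ for all $x,y$. An embedding is an injective $\mathcal{V}$-functor that is initial, i.e. $a(x,y)=b(f(x),f(y))$ for all $x,y$. For $A\subseteq X$ put $\uparrow\! A=\{y\in X\mid k\le\bigvee_{x\in A}a(x,y)\}$; $A$ is called increasing if $A=\uparrow\! A$. The $\mathcal{V}$-category $\mathsf{H}(X,a)$ has as underlying set $\mathsf{H}X=\{A\subseteq X\mid A\text{ is increasing}\}$ and structure $\mathsf{H}a(A,B)=\bigwedge_{y\in B}\bigvee_{x\in A}a(x,y)$. *)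

(* Defs.v *)
From HB Require Import structures.
From mathcomp Require Import all_boot all_order.
From mathcomp Require Import boolp classical_sets.

Set Implicit Arguments.
Unset Strict Implicit.
Unset Printing Implicit Defensive.

Import Order.TTheory.
Local Open Scope classical_set_scope.
Local Open Scope order_scope.

(* All suprema determine all infima, see [cinfP]. *)
HB.mixin Record POrder_isComplete (d : Order.disp_t) T of Order.POrder d T := {
  csup : set T -> T ;
  csupP : forall A : set T, supremums A (csup A)
}.

#[short(type="completeLatticeType")]
HB.structure Definition CompleteLattice (d : Order.disp_t) :=
  { T of POrder_isComplete d T & Order.POrder d T }.

Definition cinf (d : Order.disp_t) (T : completeLatticeType d) (A : set T) : T :=
  csup (lbound A).

(* The tensor and its unit are the monoid operations [*%g] and [1%g]. *)
HB.mixin Record CompleteMonoid_isQuantale (d : Order.disp_t) T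
    of CompleteLattice d T & Monoid T := {
  tensorC : forall u v : T, (u * v = v * u)%g ;
  tensor_csup : forall (u : T) (A : set T),
    (u * csup A)%g = csup [set (u * v)%g | v in A]
}.

(* commutative unital quantales *)
#[short(type="quantaleType")]
HB.structure Definition Quantale (d : Order.disp_t) :=
  { T of CompleteMonoid_isQuantale d T & CompleteLattice d T & Monoid T }.

Definition quantale_trivial (d : Order.disp_t) (V : quantaleType d) : Prop :=
  [set: V] = [set 1%g].

Record vcategory (d : Order.disp_t) (V : quantaleType d) := VCategory {
  vcat_sort :> Type ;
  vhom : vcat_sort -> vcat_sort -> V ;
  vhom_refl : forall x, (1%g : V) <= vhom x x ;
  vhom_trans : forall x y z, (vhom x y * vhom y z)%g <= vhom x z
}.

Section Maps.
Variables (d : Order.disp_t) (V : quantaleType d) (X Y : vcategory V).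
Implicit Type f : X -> Y.

Definition is_vfunctor f : Prop := forall x y, vhom x y <= vhom (f x) (f y).

Definition is_initial f : Prop := forall x y, vhom x y = vhom (f x) (f y).

Definition is_embedding f : Prop :=
  [/\ is_vfunctor f, injective f & is_initial f].

End Maps.

Section CompleteLatticeTheory.
Variables (d : Order.disp_t) (T : completeLatticeType d).
Implicit Types (A : set T) (x y : T).

Lemma csup_ub A x : A x -> x <= csup A.
Proof. by have [ub _] := csupP A; exact: ub. Qed.

Lemma csup_le A y : (forall x, A x -> x <= y) -> csup A <= y.
Proof. by have [_ lub] := csupP A; exact: lub. Qed.

Lemma cinfP A : infimums A (cinf A).
Proof.
split=> x Ax; last exact: csup_ub.
by apply: csup_le => y; apply.
Qed.

Lemma cinf_lb A x : A x -> cinf A <= x.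
Proof. by have [lb _] := cinfP A; exact: lb. Qed.

Lemma cinf_ge A y : (forall x, A x -> y <= x) -> y <= cinf A.
Proof. by have [_ glb] := cinfP A; exact: glb. Qed.

End CompleteLatticeTheory.

Section QuantaleTheory.
Variables (d : Order.disp_t) (V : quantaleType d).
Implicit Types u v w : V.

Lemma tensor_monol u v w : v <= w -> (u * v)%g <= (u * w)%g.
Proof.
move=> vw; have -> : w = csup [set v; w].
  apply/le_anti/andP; split; first by apply: csup_ub; right.
  by apply: csup_le => x [] ->.
by rewrite tensor_csup; apply: csup_ub; exists v => //; left.
Qed.

Lemma tensor_monor u v w : v <= w -> (v * u)%g <= (w * u)%g.
Proof. by rewrite ![(_ * u)%g]tensorC; exact: tensor_monol. Qed.

End QuantaleTheory.

Section Hausdorff.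
Variables (d : Order.disp_t) (V : quantaleType d) (X : vcategory V).
Implicit Types A B C : set X.

Definition upset A : set X :=
  [set y | (1%g : V) <= csup [set vhom x y | x in A]].

Definition increasing A : Prop := A = upset A.

Definition Hhom A B : V :=
  cinf [set csup [set vhom x y | x in A] | y in B].

Lemma Hhom_refl A : (1%g : V) <= Hhom A A.
Proof.
apply: cinf_ge => _ [y Ay <-]; apply: le_trans (vhom_refl y) _.
by apply: csup_ub; exists y.
Qed.

Lemma Hhom_trans A B C : (Hhom A B * Hhom B C)%g <= Hhom A C.
Proof.
apply: cinf_ge => _ [z Cz <-].
have HBz : Hhom B C <= csup [set vhom y z | y in B] by apply: cinf_lb; exists z.
apply: le_trans (tensor_monol _ HBz) _; rewrite tensor_csup.
apply: csup_le => _ [_ [y By <-] <-].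
have HAy : Hhom A B <= csup [set vhom x y | x in A] by apply: cinf_lb; exists y.
apply: le_trans (tensor_monor _ HAy) _; rewrite tensorC tensor_csup.
apply: csup_le => _ [_ [x Ax <-] <-]; rewrite tensorC.
by apply: le_trans (vhom_trans x y z) _; apply: csup_ub; exists x.
Qed.

Definition increasing_set : Type := {A : set X | increasing A}.

Definition Hausdorff : vcategory V :=
  @VCategory d V increasing_set
    (fun P Q => Hhom (sval P) (sval Q))
    (fun P => Hhom_refl (sval P))
    (fun P Q R => Hhom_trans (sval P) (sval Q) (sval R)).

End Hausdorff.

(* Main.v *)
Require Import Defs.
From HB Require Import structures.
From mathcomp Require Import all_boot all_order.
From mathcomp Require Import boolp classical_sets.

(** The proof is Russell's paradox carried out with values in [V].  Write [A(y)]
    for the supremum of [a(x, y)] over [x] in [A], and let [f] be an initial map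
    from the increasing sets to [X].  Call an increasing set [B] Russell when
    [B(f B)] is the bottom element; asking only that [f B] lie outside [B] would
    be too weak, because a supremum of values not above [k] may well be above [k].
    Let [A] be the upward closure of the set of all [f B] with [B] Russell.
    For such [B], the point [f B] is in [A], so initiality gives
    [a(f B, f A) = Ha(B, A) <= B(f B)], which is bottom.  Passing from a set to
    its upward closure does not change the suprema [A(y)]
    ([csup_vhom_upset]), hence [A(f A)] is bottom: [A] is itself Russell.
    But then [f A] is in [A], so [k <= a(f A, f A) <= A(f A)] puts [k] below
    bottom, which forces [V] to be trivial ([quantale_trivial_unit_le_bot]). *)

Set Implicit Arguments.
Unset Strict Implicit.
Unset Printing Implicit Defensive.

Import Order.TTheory.
Local Open Scope classical_set_scope.
Local Open Scope order_scope.

(** Since the tensor preserves the empty supremum, bottom is absorbing; a unit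
    below bottom therefore drags every element down to bottom. *)
Lemma quantale_trivial_unit_le_bot (d : Order.disp_t) (V : quantaleType d) :
  (1%g : V) <= csup set0 -> quantale_trivial V.
Proof.
move=> k_bot.
have le_bot (u : V) : u <= csup set0.
  have := tensor_monol u k_bot.
  by rewrite mulg1 tensor_csup image_set0.
have bot_le (u : V) : csup set0 <= u by apply: csup_le.
apply/seteqP; split=> // u _ /=.
by apply/le_anti; rewrite (le_trans (le_bot u)) ?(le_trans (le_bot 1%g)).
Qed.

Section Upset.
Variables (d : Order.disp_t) (V : quantaleType d) (X : vcategory V).
Implicit Types (A : set X) (x y : X).

Lemma sub_upset A : A `<=` upset A.
Proof.
move=> x Ax; apply: le_trans (vhom_refl x) _.
by apply: csup_ub; exists x.
Qed.

(** A point [x] of the closure satisfies [k <= A(x)], and transitivity gives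
    [A(x) * a(x, y) <= A(y)]; so [a(x, y)] contributes nothing new to [A(y)]. *)
Lemma csup_vhom_upset A y :
  csup [set vhom x y | x in upset A] <= csup [set vhom x y | x in A].
Proof.
apply: csup_le => _ [x Ax <-].
rewrite -[vhom x y]mulg1; apply: le_trans (tensor_monol _ Ax) _.
rewrite tensor_csup; apply: csup_le => _ [_ [z Az <-] <-].
rewrite tensorC; apply: le_trans (vhom_trans z x y) _.
by apply: csup_ub; exists z.
Qed.

Lemma increasing_upset A : increasing (upset A).
Proof.
apply/seteqP; split; first exact: sub_upset.
by move=> y /le_trans; apply; exact: csup_vhom_upset.
Qed.

End Upset.

Section Russell.
Variables (d : Order.disp_t) (V : quantaleType d) (X : vcategory V).
Variable f : Hausdorff X -> X.

Definition russell (B : Hausdorff X) : Prop :=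
  csup [set vhom x (f B) | x in sval B] <= csup set0.

Definition russell_set : Hausdorff X :=
  exist _ (upset (f @` russell)) (increasing_upset (f @` russell)).

Lemma russell_set_mem B : russell B -> sval russell_set (f B).
Proof. by move=> rB; apply: sub_upset; exists B. Qed.

(** The Hausdorff infimum over [russell_set] includes the index [f B], for which
    the corresponding term is [B(f B)]. *)
Lemma russell_russell_set : is_initial f -> russell russell_set.
Proof.
move=> f_init; apply: le_trans (csup_vhom_upset _ _) _.
apply: csup_le => _ [_ [B rB <-] <-]; rewrite -f_init.
apply: le_trans (rB); apply: cinf_lb.
by exists (f B) => //; exact: russell_set_mem.
Qed.

Lemma initial_unit_le_bot : is_initial f -> (1%g : V) <= csup set0.
Proof.
move=> f_init; have rA := russell_russell_set f_init.
apply: le_trans (rA); apply: le_trans (vhom_refl (f russell_set)) _.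
by apply: csup_ub; exists (f russell_set) => //; exact: russell_set_mem.
Qed.

End Russell.

Theorem theorem3p16 (d : Order.disp_t) (V : quantaleType d)
    (V_nontrivial : ~ quantale_trivial V) (X : vcategory V)
    (f : Hausdorff X -> X) (f_functor : is_vfunctor f) :
  ~ is_embedding f.
Proof.
case=> _ _ f_init; apply: V_nontrivial.
by apply: quantale_trivial_unit_le_bot; apply: initial_unit_le_bot f_init.
Qed.
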